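(* Let $N_*=(N_{k,i})_{k\ge1,\,i\in\{1,2,3\}}$ be any sequence of positive integers and let $\Omega=\Omega[N_*]$ be the greatest common divisor of all the numbers $N_{k,2}$ and $N_{k,3}$, $k\ge1$. The formal normal $\mathbf{n}^\Phi_\infty$ has rotational symmetry of order $7\Omega$: for all $\rho\in\,]0,1[$ and all $\varphi$, $\mathbf n_\infty^\Phi(\rho,\varphi+\frac{2\pi}{7\Omega})=R\,\mathbf n^\Phi_\infty(\rho,\varphi)$, where $R$ is the rotation of angle $\frac{2\pi}{7\Omega}$ about the third coordinate axis of $\mathbb{E}^3$.
   Context: Points are given in polar coordinates $(\rho,\varphi)$, $0<\rho<1$, $\varphi\in\mathbb{R}/2\pi\mathbb{Z}$; tangent spaces are identified with $\mathbb{R}^2$ by the direct basis $(\partial_\rho,\partial_\varphi)$. $\wedge$ is the cross product in $\mathbb{E}^3$; $\Psi^*\langle\cdot,\cdot\rangle(v,w)=\langle\Psi v,\Psi w\rangle$. $J_0$ is the Bessel function of the first kind of order 0, $\kappa_0$ its first positive zero, $J_0^{-1}:\,]0,1]\to[0,\kappa_0[$ the inverse of $J_0|_{[0,\kappa_0[}$. Data. $a=\frac{7}{2\pi}$; $\varpi_1=-\rho$, $\varpi_2=\rho-a\varphi$, $\varpi_3=\rho+a\varphi$; $\ell_i=d\varpi_i$; for $B=E\,d\rho^2+F(d\rho\otimes d\varphi+d\varphi\otimes d\rho)+G\,d\varphi^2$, $H_1(B)=E-\frac{G}{a^2}$, $H_2(B)=\frac{G}{2a^2}-\frac{F}{2a}$,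 $H_3(B)=\frac{G}{2a^2}+\frac{F}{2a}$ (so $B=\sum_iH_i(B)\ell_i\otimes\ell_i$). $f_0(\rho,\varphi)=2(\rho\cos\varphi,\rho\sin\varphi,\frac{\sqrt2}{2}\rho^2)$, and $g_k=f_0^*\langle\cdot,\cdot\rangle+4\sum_{n=1}^k(n+2)\rho^{2(n+1)}d\rho^2+4\sum_{n=1}^k(n+1)\rho^{2(n+1)}d\varphi^2$. Frame of $(\Psi,\ell)$. For an injective linear map $\Psi:\mathbb{R}^2\to\mathbb{E}^3$ and a nonzero linear form $\ell$, let $(v,w)$ be a direct basis of $\mathbb{R}^2$ with $\ell(v)>0$, $w\in\ker\ell$; the frame is $(\mathbf t,\mathbf w,\mathbf n)$ with $\mathbf w=\frac{\Psi(w)}{\|\Psi(w)\|}$, $\mathbf n=\frac{\Psi(v)\wedge\Psi(w)}{\|\Psi(v)\wedge\Psi(w)\|}$, $\mathbf t=\mathbf w\wedge\mathbf n$. Formal corrugation process. For $\eta\ge0$ and an integer $N\ge1$, pointwise $FCP(\Phi,\eta,\varpi,N)=\Phi+\big(r(\cos\theta\,\mathbf t+\sin\theta\,\mathbf n)-\Phi(u)\big)\otimes d\varpi$, where $(\mathbf t,\mathbf w,\mathbf n)$ is the frame of $(\Phi,d\varpi)$, $u$ is the vector with $\Phi(u)$ collinear to $\mathbf t$ and $d\varpi(u)=1$, $r=\sqrt{\eta+\|\Phi(u)\|^2}$, $\alpha=J_0^{-1}(\|\Phi(u)\|/r)$, $\theta=\alpha\cos(2\pi N\varpi)$. Formal analogue.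 $\Phi_{1,0}=df_0$, $\Phi_{k,i}=FCP(\Phi_{k,i-1},\eta_{k,i},\varpi_i,N_{k,i})$ with $\eta_{k,i}=H_i(g_k-\Phi_{k,i-1}^*\langle\cdot,\cdot\rangle)$, $i=1,2,3$, $\Phi_{k+1,0}=\Phi_{k,3}$. This sequence is well defined for every $N_*$ and converges on $0<\rho<1$ to a continuous field $\Phi_\infty$ of injective linear maps with $\Phi_\infty^*\langle\cdot,\cdot\rangle=h=4\frac{d\rho^2+\rho^2d\varphi^2}{(1-\rho^2)^2}$. The formal normal $\mathbf n^\Phi_\infty(\rho,\varphi)$ is the unit normal $\mathbf n$ of $\Phi_\infty(\rho,\varphi)$ (third vector of the frame of $(\Phi_\infty,\ell_1)$). *)

(* Defs.v *)
From HB Require Import structures.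
From mathcomp Require Import all_boot all_order all_algebra.
From mathcomp Require Import all_classical all_reals all_analysis.
From mathcomp Require Import ring.
Set Implicit Arguments.
Unset Strict Implicit.
Unset Printing Implicit Defensive.
Import Order.TTheory GRing.Theory Num.Theory.
Import numFieldNormedType.Exports.
Local Open Scope classical_set_scope.
Local Open Scope ring_scope.

(* Conventions.  Vectors are row vectors.  A point of the annulus is a row     *)
(* [p : 'rV[R]_2] of polar coordinates (rho, phi), phi being a real lift of    *)
(* the angle.  A linear map Psi : R^2 -> E^3 is a matrix ['M[R]_(2, 3)] acting *)
(* by [v |-> v *m Psi], in the coordinate basis of R^2 and the canonical basis *)
(* of E^3.  A linear form is a function ['rV[R]_2 -> R].                        *)

Section Euclidean.
Variable R : realType.

Definition vec2 (x y : R) : 'rV[R]_2 := \row_j [tuple x; y]`_j.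

Definition vec3 (x y z : R) : 'rV[R]_3 := \row_j [tuple x; y; z]`_j.

Definition dot (u v : 'rV[R]_3) : R := \sum_j u 0 j * v 0 j.

(* The library norm on ['rV[R]_3] is the sup norm, hence this one. *)
Definition enorm (u : 'rV[R]_3) : R := Num.sqrt (dot u u).

Definition unitv (u : 'rV[R]_3) : 'rV[R]_3 := (enorm u)^-1 *: u.

Definition cross (u v : 'rV[R]_3) : 'rV[R]_3 :=
  vec3 (u 0 1 * v 0 2%:R - u 0 2%:R * v 0 1)
       (u 0 2%:R * v 0 0 - u 0 0 * v 0 2%:R)
       (u 0 0 * v 0 1 - u 0 1 * v 0 0).

Definition rotz (t : R) (u : 'rV[R]_3) : 'rV[R]_3 :=
  vec3 (cos t * u 0 0 - sin t * u 0 1)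
       (sin t * u 0 0 + cos t * u 0 1)
       (u 0 2%:R).

(* Gram matrix, in the coordinate basis, of (v, w) |-> <Psi v, Psi w>. *)
Definition pullback (Psi : 'M[R]_(2, 3)) : 'M[R]_2 :=
  \matrix_(i, j) dot (row i Psi) (row j Psi).

End Euclidean.

Section Bessel.
Variable R : realType.

Definition J0 (x : R) : R :=
  limn (series (fun m => (-1) ^+ m / (m`!%:R ^+ 2) * (x / 2) ^+ (2 * m))).

Definition kappa0 : R := inf [set x : R | 0 < x /\ J0 x = 0].

Definition J0inv : R -> R := 'pinv_(fun=> 0) `[0, kappa0[ J0.

End Bessel.

Section Corrugation.
Variable R : realType.

Definition det2 (v w : 'rV[R]_2) : R := v 0 0 * w 0 1 - v 0 1 * w 0 0.

Definition adapted_basis (l : 'rV[R]_2 -> R) : set ('rV[R]_2 * 'rV[R]_2) :=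
  [set b | 0 < det2 b.1 b.2 /\ 0 < l b.1 /\ l b.2 = 0].

(* The frame does not depend on the choice of the adapted basis, see [frameE]. *)
Definition adapted (l : 'rV[R]_2 -> R) : 'rV[R]_2 * 'rV[R]_2 :=
  xget (0, 0) (adapted_basis l).

Definition frame_w (Psi : 'M[R]_(2, 3)) (l : 'rV[R]_2 -> R) : 'rV[R]_3 :=
  unitv ((adapted l).2 *m Psi).

Definition frame_n (Psi : 'M[R]_(2, 3)) (l : 'rV[R]_2 -> R) : 'rV[R]_3 :=
  unitv (cross ((adapted l).1 *m Psi) ((adapted l).2 *m Psi)).

Definition frame_t (Psi : 'M[R]_(2, 3)) (l : 'rV[R]_2 -> R) : 'rV[R]_3 :=
  cross (frame_w Psi l) (frame_n Psi l).

Lemma unitvZ (c : R) (u : 'rV[R]_3) : 0 < c -> unitv (c *: u) = unitv u.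
Proof.
move=> c0.
have -> : unitv (c *: u) = (c * enorm u)^-1 *: (c *: u).
  congr (_^-1 *: _); rewrite /enorm.
  have -> : dot (c *: u) (c *: u) = c ^+ 2 * dot u u.
    by rewrite /dot mulr_sumr; apply: eq_bigr => j _; rewrite !mxE; ring.
  by rewrite sqrtrM ?sqr_ge0// sqrtr_sqr gtr0_norm.
by rewrite scalerA invfM -mulrA mulrCA mulVf ?gt_eqF// mulr1.
Qed.

Lemma cross_lin (x y z : R) (u v : 'rV[R]_3) :
  cross (x *: u + y *: v) (z *: v) = (x * z) *: cross u v.
Proof.
by apply/rowP => -[[|[|[|//]]] hj]; rewrite !mxE /=; ring.
Qed.

Lemma frameE (Psi : 'M[R]_(2, 3)) (l : {linear 'rV[R]_2 -> R^o}) v w :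
  adapted_basis l (v, w) ->
  frame_w Psi l = unitv (w *m Psi) /\
  frame_n Psi l = unitv (cross (v *m Psi) (w *m Psi)).
Proof.
move=> -[/= vw [lv lw]]; rewrite /frame_w /frame_n /adapted.
case: xgetP => [[v0 w0] _ [/= D [lv0 lw0]]|no]; last by case: (no (v, w)).
have dec u : u = (det2 u w0 / det2 v0 w0) *: v0
               + (det2 v0 u / det2 v0 w0) *: w0.
  have D0 : det2 v0 w0 != 0 by rewrite gt_eqF.
  apply: (scalerI D0); rewrite scalerDr !scalerA ![_ * (_ / _)]mulrC !mulfVK//.
  apply/rowP => j; rewrite !mxE /det2.
  have [->|->] : j = 0 \/ j = 1.
  - by case: j => -[|[|//]] hj; [left|right]; exact: val_inj.
  - ring.
  - ring.
have lE u : l u = (det2 u w0 / det2 v0 w0) * l v0.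
  by rewrite {1}(dec u) linearD !linearZ /= lw0 scaler0 addr0.
have w00 : det2 w w0 / det2 v0 w0 = 0.
  by move/eqP: lw; rewrite lE mulf_eq0 (gt_eqF lv0) orbF => /eqP.
have {w00}wE : w = (det2 v0 w / det2 v0 w0) *: w0.
  by rewrite {1}(dec w) w00 scale0r add0r.
have x0 : 0 < det2 v w0 / det2 v0 w0 by move: lv; rewrite lE pmulr_lgt0.
have vE := dec v.
move: (_ / _) (_ / _) (_ / _) x0 vE wE => z y x x0 vE wE.
have z0 : 0 < z.
  move: vw; have -> : det2 v w = x * z * det2 v0 w0.
    by rewrite vE wE /det2 !mxE; ring.
  by rewrite pmulr_lgt0// pmulr_rgt0.
rewrite vE wE mulmxDl -!scalemxAl cross_lin !unitvZ//.
exact: mulr_gt0.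
Qed.

(* Such a vector exists and is unique when Psi is injective and l nonzero. *)
Definition frame_u (Psi : 'M[R]_(2, 3)) (l : 'rV[R]_2 -> R) : 'rV[R]_2 :=
  xget 0 [set u | (exists c, u *m Psi = c *: frame_t Psi l) /\ l u = 1].

Definition FCP (Phi : 'M[R]_(2, 3)) (eta : R) (varpi : 'rV[R]_2 -> R) (N : nat)
    (p : 'rV[R]_2) : 'M[R]_(2, 3) :=
  let l : 'rV[R]_2 -> R := 'd varpi p in
  let Phiu := frame_u Phi l *m Phi in
  let r := Num.sqrt (eta + enorm Phiu ^+ 2) in
  let alpha := J0inv (enorm Phiu / r) in
  let theta := alpha * cos (2 * pi * N%:R * varpi p) in
  let z := r *: (cos theta *: frame_t Phi l + sin theta *: frame_n Phi l) in
  Phi + lin1_mx (fun v => l v *: (z - Phiu)).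

End Corrugation.

Section FormalAnalogue.
Variable R : realType.

Definition a : R := 7 / (2 * pi).

Definition varpi (i : nat) (p : 'rV[R]_2) : R :=
  match i with
  | 1 => - p 0 0
  | 2 => p 0 0 - a * p 0 1
  | _ => p 0 0 + a * p 0 1
  end.

Definition H (i : nat) (B : 'M[R]_2) : R :=
  let E := B 0 0 in let F := B 0 1 in let G := B 1 1 in
  match i with
  | 1 => E - G / a ^+ 2
  | 2 => G / (2 * a ^+ 2) - F / (2 * a)
  | _ => G / (2 * a ^+ 2) + F / (2 * a)
  end.

Definition f0 (p : 'rV[R]_2) : 'rV[R]_3 :=
  let rho := p 0 0 in let phi := p 0 1 in
  2 *: vec3 (rho * cos phi) (rho * sin phi) (Num.sqrt 2 / 2 * rho ^+ 2).

(* [delta_mx 0 0] and [delta_mx 1 1] are the forms d rho^2 and d phi^2. *)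
Definition g (k : nat) (p : 'rV[R]_2) : 'M[R]_2 :=
  let rho := p 0 0 in
  pullback ('J f0 p)
  + (4 * \sum_(1 <= n < k.+1) (n + 2)%:R * rho ^+ (2 * (n + 1)))
      *: delta_mx 0 0
  + (4 * \sum_(1 <= n < k.+1) (n + 1)%:R * rho ^+ (2 * (n + 1)))
      *: delta_mx 1 1.

Definition corrugate (N : nat -> nat -> nat) (k i : nat)
    (Phi : 'rV[R]_2 -> 'M[R]_(2, 3)) : 'rV[R]_2 -> 'M[R]_(2, 3) :=
  fun p => FCP (Phi p) (H i (g k p - pullback (Phi p))) (varpi i) (N k i) p.

(* The fields Phi_{1,0}, Phi_{1,1}, Phi_{1,2}, Phi_{1,3} = Phi_{2,0},          *)
(* Phi_{2,1}, ... as a single sequence: the term of index n is Phi_{k,i} for   *)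
(* n = 3 (k - 1) + i, see [PhiS].                                              *)
Fixpoint Phi_seq (N : nat -> nat -> nat) (n : nat) :
    'rV[R]_2 -> 'M[R]_(2, 3) :=
  if n is m.+1 then corrugate N (m %/ 3).+1 (m %% 3).+1 (Phi_seq N m)
  else fun p => 'J f0 p.

Definition Phi (N : nat -> nat -> nat) (k i : nat) :
  'rV[R]_2 -> 'M[R]_(2, 3) := Phi_seq N (3 * k.-1 + i).

Definition Phi_infty (N : nat -> nat -> nat) (p : 'rV[R]_2) : 'M[R]_(2, 3) :=
  limn (Phi_seq N ^~ p).

Definition formal_normal (N : nat -> nat -> nat) (rho phi : R) : 'rV[R]_3 :=
  let p := vec2 rho phi in frame_n (Phi_infty N p) ('d (varpi 1) p).

End FormalAnalogue.

Definition common_divisor (N : nat -> nat -> nat) : set nat :=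
  [set d | forall k, (1 <= k)%N -> (d %| N k 2)%N /\ (d %| N k 3)%N].

Definition Omega (N : nat -> nat -> nat) : nat :=
  xget 0%N [set d | common_divisor N d /\
                    forall e, common_divisor N e -> (e <= d)%N].

Lemma OmegaP (N : nat -> nat -> nat) : (0 < N 1 2)%N ->
  common_divisor N (Omega N) /\
  forall e, common_divisor N e -> (e <= Omega N)%N.
Proof.
move=> N0; rewrite /Omega; case: xgetP => [d _ //|no]; exfalso.
have ex1 : exists d, `[< common_divisor N d >].
  by exists 1%N; apply/asboolP => k _; rewrite !dvd1n.
have ub d : `[< common_divisor N d >] -> (d <= N 1 2)%N.
  by move=> /asboolP /(_ 1%N isT) [/dvdn_leq + _]; apply.
case: (ex_maxnP ex1 ub) => d /asboolP dN dmax.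
by apply: (no d); split => // e /asboolP; exact: dmax.
Qed.

Section Checks.
Variable R : realType.

Lemma Phi_start (N : nat -> nat -> nat) (p : 'rV[R]_2) :
  Phi N 1 0 p = 'J (@f0 R) p.
Proof. by []. Qed.

Lemma PhiS (N : nat -> nat -> nat) (k i : nat) (p : 'rV[R]_2) :
  (1 <= k)%N -> (1 <= i <= 3)%N ->
  Phi N k i p = FCP (Phi N k i.-1 p) (H i (g k p - pullback (Phi N k i.-1 p)))
                    (varpi i) (N k i) p.
Proof.
case: k => [//|k] _; case: i => [//|i] /andP[_ i3].
have Ek : ((3 * k + i) %/ 3 = k)%N by rewrite mulnC divnMDl // divn_small ?addn0.
have Ei : ((3 * k + i) %% 3 = i)%N by rewrite mulnC modnMDl modn_small.
have -> : Phi N k.+1 i.+1 p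
    = corrugate N ((3 * k + i) %/ 3).+1 ((3 * k + i) %% 3).+1 (Phi N k.+1 i) p.
  by rewrite /Phi addnS.
by rewrite Ek Ei.
Qed.

Lemma Phi_next (N : nat -> nat -> nat) (k : nat) (p : 'rV[R]_2) :
  (1 <= k)%N -> Phi N k.+1 0 p = Phi N k 3 p.
Proof. case: k => // k _; rewrite /Phi.
by have -> : (3 * k.+2.-1 + 0 = 3 * k.+1.-1 + 3)%N by rewrite addn0 mulnS addnC.
 Qed.

End Checks.

(* Main.v *)
(** Shifting the angle by [T = 2 pi / (7 Omega)] shifts [a phi] by [1 / Omega],
    so that every phase [2 pi N_{k,i} varpi_i] with [i = 2, 3] moves by a
    multiple of [2 pi], and those with [i = 1] do not move at all.  Since
    [f0] is equivariant under this shift and the rotation [Q] of angle [T],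
    while the frame, the pullback metric and hence the corrugation process
    commute with rotations of the target, induction gives
    [Phi_{k,i}(rho, phi + T) = Phi_{k,i}(rho, phi) Q] for all [k, i]; the
    identity passes to the limit and to its normal. *)
From HB Require Import structures.
Require Import Defs.
From mathcomp Require Import all_boot all_order all_algebra.
From mathcomp Require Import all_classical all_reals all_analysis.
From mathcomp Require Import ring.
Import Order.TTheory GRing.Theory Num.Theory.
Import numFieldNormedType.Exports.
Local Open Scope ring_scope.

Set Implicit Arguments.
Unset Strict Implicit.
Unset Printing Implicit Defensive.

(** * Right multiplication by a fixed matrix, and limits *)

Section MulmxContinuity.
Context {R : realType}.

(** Expanded over elementary matrices, the map is a finite sum of coordinate functions times
    constant matrices. *)
Lemma mulmxr_continuous m n p (Q : 'M[R]_(n, p)) :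
  continuous (mulmxr Q : 'M[R]_(m, n) -> 'M[R]_(m, p)).
Proof.
have -> : (mulmxr Q : 'M[R]_(m, n) -> _) =
    fun A => \sum_i \sum_j A i j *: (delta_mx i j *m Q).
  apply/funext => A; rewrite /= {1}(matrix_sum_delta A) mulmx_suml.
  apply: eq_bigr => i _; rewrite mulmx_suml.
  by apply: eq_bigr => j _; rewrite -scalemxAl.
have addc : continuous (fun X : 'M[R]_(m, p) * 'M[R]_(m, p) => X.1 + X.2).
  exact: add_continuous.
move=> A; apply: (cvg_big addc (nbhs_filter A)) => i _.
apply: (cvg_big addc (nbhs_filter A)) => j _.
by apply: cvgZr_tmp; exact: coord_continuous.
Qed.

(* Invertibility of [Q] makes this hold for divergent sequences too, whose
   [limn] is the default value [0]. *)
Lemma limn_mulmxr m n p (Q : 'M[R]_(n, p)) (Q' : 'M[R]_(p, n))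
    (u : nat -> 'M[R]_(m, n)) :
  Q *m Q' = 1%:M -> limn (fun k => u k *m Q) = limn u *m Q.
Proof.
move=> QQ'; have [cu|ncu] := pselect (cvgn u).
  by apply: cvg_lim => //; exact: continuous_cvg (@mulmxr_continuous m n p Q _) cu.
have point0 k : (point : 'M[R]_(m, k)) = 0 by apply/matrixP => i j; rewrite !mxE.
rewrite (dvgP ncu) point0 mul0mx.
(* A limit [A] of the products would make [u] converge to [A *m Q']. *)
rewrite dvgP ?point0// => /cvg_ex[A uQA]; apply: ncu.
apply/cvg_ex; exists (A *m Q').
have uE : (fun k => u k *m Q *m Q') = u.
  by apply/funext => k; rewrite -mulmxA QQ' mulmx1.
rewrite -uE; exact: continuous_cvg (@mulmxr_continuous m p n Q' _) uQA.
Qed.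

End MulmxContinuity.

Lemma diff_shift (K : numFieldType) (V W : normedModType K) (f : V -> W) (v x : V) :
  differentiable f (x + v) -> 'd (f \o shift v) x = 'd f (x + v) :> (V -> W).
Proof.
move=> df; have [ds dsE] : is_diff x (shift v) id.
  have -> : shift v = id + cst v by [].
  by apply: is_diff_eq; rewrite addr0.
by rewrite diff_comp// dsE.
Qed.

(** * Invariance of frames and corrugations under rotations of the target *)

Section Rotations.
Context {R : realType}.

(** For an orthogonal matrix, commuting with [cross] amounts to determinant 1; frames are built from
    exactly these two structures. *)
Definition is_rotation (Q : 'M[R]_3) :=
  Q *m Q^T = 1%:M /\
  forall u v : 'rV[R]_3, cross (u *m Q) (v *m Q) = cross u v *m Q.

Lemma dotE (u v : 'rV[R]_3) : dot u v = (u *m v^T) 0 0.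
Proof. by rewrite mxE; apply: eq_bigr => j _; rewrite mxE. Qed.

Lemma ord3_ind (P : 'I_3 -> Prop) : P 0 -> P 1 -> P 2%:R -> forall i, P i.
Proof.
move=> P0 P1 P2 [[|[|[|//]]] hi].
- by rewrite (_ : Ordinal hi = 0)//; exact: val_inj.
- by rewrite (_ : Ordinal hi = 1)//; exact: val_inj.
- by rewrite (_ : Ordinal hi = 2%:R)//; exact: val_inj.
Qed.

Lemma big_ord3 (F : 'I_3 -> R) : \sum_i F i = F 0 + F 1 + F 2%:R.
Proof.
rewrite !big_ord_recl big_ord0 addr0 addrA.
by congr (_ + F _ + F _); exact: val_inj.
Qed.

Lemma rotzE t (u : 'rV[R]_3) : rotz t u = u *m lin1_mx (rotz t).
Proof.
apply/rowP => j; rewrite [RHS]mxE big_ord3.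
by elim/ord3_ind: j; rewrite !mxE /=; ring.
Qed.

Lemma rotz_is_rotation t : is_rotation (lin1_mx (rotz t)).
Proof.
have c2 : cos t * cos t = 1 - sin t * sin t.
  by rewrite -!expr2 -(cos2Dsin2 t) addrK.
split=> [|u v].
  apply/matrixP => i j; rewrite mxE big_ord3.
  by elim/ord3_ind: i; elim/ord3_ind: j; rewrite !mxE /=; ring: c2.
rewrite -!rotzE; apply/rowP; elim/ord3_ind; rewrite !mxE /=; ring: c2.
Qed.

Context (Q : 'M[R]_3) (rotQ : is_rotation Q).

Lemma mulmx_rotationK m : cancel (mulmx^~ Q : 'M[R]_(m, 3) -> _) (mulmx^~ Q^T).
Proof. by move=> A; rewrite -mulmxA rotQ.1 mulmx1. Qed.

Lemma dot_rotation u v : dot (u *m Q) (v *m Q) = dot u v.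
Proof. by rewrite !dotE trmx_mul mulmxA mulmx_rotationK. Qed.

Lemma enorm_rotation u : enorm (u *m Q) = enorm u.
Proof. by rewrite /enorm dot_rotation. Qed.

Lemma unitv_rotation u : unitv (u *m Q) = unitv u *m Q.
Proof. by rewrite /unitv enorm_rotation scalemxAl. Qed.

Lemma pullback_rotation (Psi : 'M[R]_(2, 3)) : pullback (Psi *m Q) = pullback Psi.
Proof. by apply/matrixP => i j; rewrite !mxE !row_mul dot_rotation. Qed.

Section Frame.
Context (Psi : 'M[R]_(2, 3)) (l : 'rV[R]_2 -> R).

Lemma frame_w_rotation : frame_w (Psi *m Q) l = frame_w Psi l *m Q.
Proof. by rewrite /frame_w mulmxA unitv_rotation. Qed.

Lemma frame_n_rotation : frame_n (Psi *m Q) l = frame_n Psi l *m Q.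
Proof. by rewrite /frame_n !mulmxA rotQ.2 unitv_rotation. Qed.

Lemma frame_t_rotation : frame_t (Psi *m Q) l = frame_t Psi l *m Q.
Proof. by rewrite /frame_t frame_w_rotation frame_n_rotation rotQ.2. Qed.

Lemma frame_u_rotation : frame_u (Psi *m Q) l = frame_u Psi l.
Proof.
(* Both sides choose from the same set of vectors, with the same coefficient [c], so [xget] returns
   the same one. *)
congr xget; apply/seteqP; split=> u /= [[c uc] lu]; split=> //; exists c.
  apply: (can_inj (@mulmx_rotationK 1)).
  by rewrite -mulmxA uc frame_t_rotation scalemxAl.
by rewrite mulmxA uc frame_t_rotation scalemxAl.
Qed.

End Frame.

Lemma mul_lin1_mx_rank1 (l : 'rV[R]_2 -> R) (w : 'rV[R]_3) :
  lin1_mx (fun v => l v *: w) *m Q = lin1_mx (fun v => l v *: (w *m Q)).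
Proof.
apply/matrixP => i j; rewrite !mxE mulr_sumr.
by apply: eq_bigr => k _; rewrite !mxE mulrA.
Qed.

(* [FCP] as a function of the only data through which it sees the point: the
   differential [l] of the phase and the cosine [c]. *)
Definition corrugation (Psi : 'M[R]_(2, 3)) (eta : R) (l : 'rV[R]_2 -> R) (c : R) :=
  let Psiu := frame_u Psi l *m Psi in
  let r := Num.sqrt (eta + enorm Psiu ^+ 2) in
  let theta := J0inv (enorm Psiu / r) * c in
  let z := r *: (cos theta *: frame_t Psi l + sin theta *: frame_n Psi l) in
  Psi + lin1_mx (fun v => l v *: (z - Psiu)).

Lemma FCPE Psi eta (w : 'rV[R]_2 -> R) N (p : 'rV[R]_2) :
  FCP Psi eta w N p = corrugation Psi eta ('d w p) (cos (2 * pi * N%:R * w p)).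
Proof. by []. Qed.

(** The scalars [r] and [theta] depend on [Psi] only through a norm, which [Q] preserves, while each
    vector involved is carried along by [Q]. *)
Lemma corrugation_rotation Psi eta l c :
  corrugation (Psi *m Q) eta l c = corrugation Psi eta l c *m Q.
Proof.
rewrite /corrugation frame_u_rotation frame_t_rotation frame_n_rotation.
rewrite mulmxA enorm_rotation mulmxDl mul_lin1_mx_rank1.
congr (_ + lin1_mx _); apply/funext => v.
move: (frame_t Psi l) (frame_n Psi l) => x y.
by rewrite !scalemxAl -mulmxDl scalemxAl -mulmxBl scalemxAl.
Qed.

Lemma FCP_rotation (Psi : 'M[R]_(2, 3)) eta (w : 'rV[R]_2 -> R) N
    (p q : 'rV[R]_2) :
  'd w q = 'd w p :> ('rV[R]_2 -> R) ->
  cos (2 * pi * N%:R * w q) = cos (2 * pi * N%:R * w p) ->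
  FCP (Psi *m Q) eta w N q = FCP Psi eta w N p *m Q.
Proof.
move=> dw cosw; rewrite !FCPE -corrugation_rotation cosw.
exact: (congr1 (fun l => corrugation (Psi *m Q) eta l _) dw).
Qed.

End Rotations.

(** * Equivariance under a shift of the angle *)

Section AngularShift.
Context {R : realType}.
Implicit Types (t : R) (p : 'rV[R]_2).

Lemma vec2D rho phi t : vec2 rho (phi + t) = vec2 rho phi + vec2 (0 : R) t.
Proof. by apply/rowP => -[[|[|//]] hj]; rewrite !mxE /= ?addr0. Qed.

Lemma f0_shift t p : f0 (p + vec2 0 t) = f0 p *m lin1_mx (rotz t).
Proof.
rewrite -rotzE; apply/rowP => -[[|[|[|//]]] hj];
  rewrite !mxE /= addr0 ?cosD ?sinD; ring.
Qed.

Lemma f0_differentiable p : differentiable (@f0 R) p.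
Proof.
have d0 := @differentiable_coord R _ _ p 0 0.
have d1 := @differentiable_coord R _ _ p 0 1.
have d2 : differentiable (fun=> 2 : R) p by exact: differentiable_cst.
have dcos : differentiable (cos \o (fun q : 'rV[R]_2 => q 0 1)) p.
  by apply: differentiable_comp => //; exact/derivable1_diffP/derivable_cos.
have dsin : differentiable (sin \o (fun q : 'rV[R]_2 => q 0 1)) p.
  by apply: differentiable_comp => //; exact/derivable1_diffP/derivable_sin.
have dsqrt2 : differentiable (fun=> Num.sqrt 2 : R) p by exact: differentiable_cst.
have dx := differentiableZl (delta_mx 0 0 : 'rV[R]_3)
  (differentiableM d2 (differentiableM d0 dcos)).
have dy := differentiableZl (delta_mx 0 1 : 'rV[R]_3)
  (differentiableM d2 (differentiableM d0 dsin)).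
(* The outer factor 2 of [f0] cancels the denominator in [Num.sqrt 2 / 2]. *)
have dz := differentiableZl (delta_mx 0 2%:R : 'rV[R]_3)
  (differentiableM dsqrt2 (differentiableM d0 d0)).
have := differentiableD (differentiableD dx dy) dz.
rewrite (_ : _ + _ = @f0 R)//.
by apply/funext => q; apply/rowP; elim/ord3_ind; rewrite !mxE !fctE /=; field.
Qed.

(** Differentiate [f0 \o shift = mulmxr Q \o f0]: the shift has differential the identity, and the
    linear map [mulmxr Q] is its own differential. *)
Lemma jacobian_f0_shift t p :
  'J (@f0 R) (p + vec2 0 t) = 'J (@f0 R) p *m lin1_mx (rotz t).
Proof.
set Q := lin1_mx _.
have Qcont := @mulmxr_continuous R 1 3 3 Q.
have dQ x : differentiable (mulmxr Q : 'rV[R]_3 -> 'rV[R]_3) x.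
  exact: linear_differentiable.
have f0E : @f0 R \o shift (vec2 0 t) = mulmxr Q \o @f0 R.
  by apply/funext => q; exact: f0_shift.
have dshift := diff_shift (@f0_differentiable (p + vec2 0 t)).
have drot := diff_comp (@f0_differentiable p) (dQ (f0 p)).
have dE := congr1 (fun f : 'rV[R]_2 -> 'rV[R]_3 => 'd f p : _ -> _) f0E.
have dlin := diff_lin (f0 p) Qcont.
have dfE (v : 'rV[R]_2) : 'd (@f0 R) (p + vec2 0 t) v = 'd (@f0 R) p v *m Q.
  have E1 := congr1 (@^~ v) dshift.
  have E2 := congr1 (@^~ v) dE.
  have E3 := congr1 (@^~ v) drot.
  have E4 := congr1 (@^~ ('d (@f0 R) p v)) dlin.
  exact: etrans (esym E1) (etrans E2 (etrans E3 E4)).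
have JE (x v : 'rV[R]_2) : v *m 'J (@f0 R) x = 'd (@f0 R) x v by exact: mul_rV_lin1.
have JvE (v : 'rV[R]_2) : v *m 'J (@f0 R) (p + vec2 0 t) = v *m 'J (@f0 R) p *m Q.
  have JQE := congr1 (mulmx^~ Q) (esym (JE p v)).
  exact: etrans (JE (p + vec2 0 t) v) (etrans (dfE v) JQE).
move: ('J (@f0 R) (p + vec2 0 t)) ('J (@f0 R) p) JvE => A B ABE.
by apply/row_matrixP => i; rewrite row_mul !rowE.
Qed.

(** Each [varpi i] is linear and continuous, hence equal to its differential at every point. *)
Lemma diff_varpi i p q : 'd (@varpi R i) p = 'd (varpi i) q :> ('rV[R]_2 -> R).
Proof.
have lin : linear (@varpi R i).
  by case: i => [|[|[|i]]] c x y; rewrite /varpi !mxE /GRing.scale /=; ring.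
pose linM := GRing.isLinear.Build _ _ _ _ _ lin.
pose f : {linear 'rV[R]_2 -> R} := HB.pack (@varpi R i) linM.
have fcont : continuous f.
  have c0 : continuous (fun q : 'rV[R]_2 => q 0 0) by exact: coord_continuous.
  have c1 : continuous (fun q : 'rV[R]_2 => a R * q 0 1).
    by move=> x; exact: cvgMr (@coord_continuous R 1 2 0 1 x).
  (* The cases are 0, 1, 2 and at least 3; the first and last share the default branch of
     [varpi]. *)
  rewrite /f /=; case: i {lin linM f} => [|[|[|i]]] x.
  - exact: cvgD (c0 x) (c1 x).
  - exact: cvgN (c0 x).
  - exact: cvgB (c0 x) (c1 x).
  - exact: cvgD (c0 x) (c1 x).
exact: etrans (diff_lin p fcont) (esym (diff_lin q fcont)).
Qed.

(** The added terms involve [rho] alone, and the pullback by [f0] changes only by a rotation of the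
    target. *)
Lemma g_shift k t p : g k (p + vec2 0 t) = g k p.
Proof.
rewrite /g jacobian_f0_shift (pullback_rotation (rotz_is_rotation t)).
by rewrite !mxE /= addr0.
Qed.

Lemma cos_phase (d n : nat) (x : R) : (0 < d)%N -> (d %| n)%N ->
  cos (2 * pi * n%:R * (x + d%:R^-1)) = cos (2 * pi * n%:R * x).
Proof.
move=> d0 /dvdnP[m ->]; rewrite -[RHS](periodicn (@cosD2pi R) m).
have dn0 : d%:R != 0 :> R by rewrite pnatr_eq0 -lt0n.
by congr cos; rewrite natrM -[_ *+ m]mulr_natr -[pi *+ 2]mulr_natl; field.
Qed.

Context (N : nat -> nat -> nat) (d : nat).
Context (d_gt0 : (0 < d)%N) (dN : common_divisor N d).
(** The symmetry is obtained for every positive common divisor [d], then specialised to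
    [Omega N]. *)
Let t : R := 2 * pi / (7 * d%:R).

Lemma a_shift : a R * t = d%:R^-1.
Proof.
rewrite /a /t; have d0 : d%:R != 0 :> R by rewrite pnatr_eq0 -lt0n.
have pi0 : pi != 0 :> R by rewrite gt_eqF ?pi_gt0.
by move: (pi : R) pi0 => x x0; field; rewrite d0 x0.
Qed.

Lemma cos_varpi_shift k i p : (1 <= k)%N -> (1 <= i <= 3)%N ->
  cos (2 * pi * (N k i)%:R * varpi i (p + vec2 0 t)) =
  cos (2 * pi * (N k i)%:R * varpi i p).
Proof.
move=> /dN[dN2 dN3]; case: i => [|[|[|[|//]]]] // _; rewrite /varpi !mxE /= addr0 //.
  (* The shift lowers [varpi 2] by [1/d], so a period is added back on the left; it raises
     [varpi 3], so there the period goes on the right. *)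
  by rewrite -[LHS](cos_phase _ d_gt0 dN2) [a R * _]mulrDr a_shift opprD addrA subrK.
by rewrite -[RHS](cos_phase _ d_gt0 dN3) [a R * _]mulrDr a_shift addrA.
Qed.

Lemma Phi_seq_shift n p :
  Phi_seq N n (p + vec2 0 t) = Phi_seq N n p *m lin1_mx (rotz t).
Proof.
have rot := rotz_is_rotation t.
elim: n p => [|n IHn] p; first exact: jacobian_f0_shift.
rewrite /= /corrugate IHn g_shift pullback_rotation//.
apply: (FCP_rotation rot); first exact: diff_varpi.
by apply: cos_varpi_shift; rewrite //= ltn_mod.
Qed.

Lemma Phi_infty_shift p :
  Phi_infty N (p + vec2 0 t) = Phi_infty N p *m lin1_mx (rotz t).
Proof.
rewrite /Phi_infty; under eq_fun do rewrite Phi_seq_shift.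
exact: limn_mulmxr (rotz_is_rotation t).1.
Qed.

Lemma formal_normal_shift rho phi :
  formal_normal N rho (phi + t) = rotz t (formal_normal N rho phi).
Proof.
rewrite rotzE -frame_n_rotation; last exact: rotz_is_rotation.
rewrite /formal_normal vec2D Phi_infty_shift.
set M := _ *m _.
exact: (congr1 (frame_n M)
  (diff_varpi 1 (vec2 rho phi + vec2 0 t) (vec2 rho phi))).
Qed.

End AngularShift.

Theorem proposition5 (R : realType) (N : nat -> nat -> nat)
    (N_gt0 : forall k i : nat, (1 <= k)%N -> (1 <= i <= 3)%N -> (0 < N k i)%N)
    (rho phi : R) (rho01 : 0 < rho < 1) :
  formal_normal N rho (phi + 2 * pi / (7 * (Omega N)%:R)) =
  rotz (2 * pi / (7 * (Omega N)%:R)) (formal_normal N rho phi).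
Proof.
have N12 : (0 < N 1%N 2%N)%N by exact: N_gt0.
have [cdO _] := OmegaP N12.
(* Dividing the positive number [N 1 2] forces [Omega N] to be positive. *)
have [dvdO _] := cdO 1%N isT.
by apply: formal_normal_shift => //; exact: dvdn_gt0 N12 dvdO.
Qed.
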